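(* Let $F$ be a finite field. Then $\Gamma(\mathbb{Z}_2\times F)$ is partitionable into global defensive alliances if and only if $F\cong \mathbb{Z}_2$.
   Context: $\mathbb{Z}_n=\mathbb{Z}/n\mathbb{Z}$. For a commutative ring $R$ with $1\neq 0$, the zero-divisor graph $\Gamma(R)$ is the simple graph whose vertices are the nonzero zero-divisors of $R$, two distinct vertices $x,y$ being adjacent if and only if $xy=0$. Let $\Gamma=(V,E)$ be a finite simple graph. For $S\subseteq V$ put $\bar S=V\setminus S$ and $\deg_S(x)=|S\cap N(x)|$, where $N(x)$ is the set of vertices adjacent to $x$. A nonempty $S\subseteq V$ is a dominating set if $\deg_S(v)>0$ for every $v\in\bar S$; it is a defensive alliance if $\deg_S(x)+1\ge \deg_{\bar S}(x)$ for every $x\in S$; it is a global defensive alliance if it is both. The global defensive alliance partition number $\psi_g(\Gamma)$ is the maximum number of sets in a partition of $V$ such that each set is a global defensive alliance; $\Gamma$ is partitionable into global defensive alliances if $\psi_g(\Gamma)\ge 2$. *)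

(* Defs.v *)
From HB Require Import structures.
From mathcomp Require Import all_boot all_order all_algebra.

Set Implicit Arguments.
Unset Strict Implicit.
Unset Printing Implicit Defensive.

Import GRing.Theory.

Structure sgraph := SGraph {
  vertex :> finType;
  adj : rel vertex;
  adj_sym : symmetric adj;
  adj_irrefl : irreflexive adj
}.

Section Alliances.
Variable G : sgraph.
Implicit Types (S : {set G}) (x : G) (P : {set {set G}}).

Definition nbhd x : {set G} := [set y | adj x y].

Definition deg_in S x : nat := #|S :&: nbhd x|.

Definition dominating S : bool :=
  (S != set0) && [forall x in ~: S, 0 < deg_in S x].

Definition defensive_alliance S : bool :=
  (S != set0) && [forall x in S, deg_in S x + 1 >= deg_in (~: S) x].

Definition global_defensive_alliance S : bool :=
  defensive_alliance S && dominating S.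

Definition gda_partition P : bool :=
  partition P [set: G] && [forall S in P, global_defensive_alliance S].

(* On a nonempty graph {V} is always a gda_partition, so the default value 0 of
   \max is never taken; on the empty graph the only partition is set0. *)
Definition psi_g : nat := \max_(P : {set {set G}} | gda_partition P) #|P|.

Definition gda_partitionable : Prop := 2 <= psi_g.

End Alliances.

(* MathComp has the ring and the finite structures on products, but not their
   join. *)
HB.instance Definition _ (R S : finComNzRingType) :=
  Finite.on (R * S)%type.

Section ZeroDivisorGraph.
Variable R : finComNzRingType.
Local Open Scope ring_scope.

Definition zero_divisor (x : R) : bool :=
  [exists y : R, (y != 0) && (x * y == 0)].

Definition zdg_vertex : finType := {x : R | (x != 0) && zero_divisor x}.

Definition zdg_adj : rel zdg_vertex :=
  fun x y => (x != y) && (val x * val y == 0).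

Lemma zdg_adj_sym : symmetric zdg_adj.
Proof. by move=> x y; rewrite /zdg_adj eq_sym mulrC. Qed.

Lemma zdg_adj_irrefl : irreflexive zdg_adj.
Proof. by move=> x; rewrite /zdg_adj eqxx. Qed.

Definition zero_divisor_graph : sgraph := SGraph zdg_adj_sym zdg_adj_irrefl.

End ZeroDivisorGraph.

Definition ring_isomorphic (R S : nzRingType) : Prop :=
  exists f : {rmorphism R -> S}, bijective f.

(* Main.v *)
(** [Gamma (Z_2 * F)] is the star with centre [(1, 0)] and leaves [(0, a)],
    [a != 0], so it has [#|F|] vertices. A class of a partition into global
    defensive alliances that avoids the centre must contain every leaf, since
    a leaf can only be dominated by the centre; hence the other class is the
    centre alone, and being a defensive alliance forces it to have at most one
    leaf. *)
Require Import Defs.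
From HB Require Import structures.
From mathcomp Require Import all_boot all_order all_algebra.

Set Implicit Arguments.
Unset Strict Implicit.
Unset Printing Implicit Defensive.

Import GRing.Theory.

Definition star (G : sgraph) (c : G) : Prop :=
  forall x y : G, adj x y = (x != y) && ((x == c) || (y == c)).

(** An empty maximum is 0, so a value of at least 2 must come from an actual partition with more
    than one class. *)
Lemma gda_partitionableP (G : sgraph) :
  gda_partitionable G <-> exists2 P : {set {set G}}, gda_partition P & 1 < #|P|.
Proof.
split=> [|[P gP P_gt1]]; last exact: leq_trans P_gt1 (leq_bigmax_cond _ gP).
rewrite /gda_partitionable /psi_g => psi_gt1.
have [/exists_inP// | /exists_inPn noP] :=
  boolP [exists (P : {set {set G}} | gda_partition P), 1 < #|P|].
move: psi_gt1; rewrite ltnNge => /negP[]; apply/bigmax_leqP => P gP.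
by rewrite leqNgt noP.
Qed.

Lemma defensive_allianceP (G : sgraph) (S : {set G}) (x : G) :
  defensive_alliance S -> x \in S -> deg_in (~: S) x <= deg_in S x + 1.
Proof. by case/andP=> _ /forall_inP/(_ x). Qed.

Section Star.

Variables (G : sgraph) (c : G).
Hypothesis starG : star c.

(** A leaf outside [S] needs a neighbour in [S], and its only neighbour is [c]. *)
Lemma star_dominating (S : {set G}) (x : G) :
  dominating S -> c \notin S -> x != c -> x \in S.
Proof.
case/andP=> _ /forall_inP domS cS xc; apply: contraNT cS => xS.
have := domS x; rewrite inE => /(_ xS) /card_gt0P[y].
by rewrite !inE starG (negPf xc) /= => /andP[yS /andP[_ /eqP <-]].
Qed.

(** The centre has no neighbour in [[set c]] and is adjacent to every other vertex, so defence reads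
    [#|G| - 1 <= 0 + 1]. *)
Lemma star_center_alone_card : defensive_alliance [set c] -> #|G| <= 2.
Proof.
move=> /defensive_allianceP/(_ (set11 c)); rewrite /deg_in.
have -> : [set c] :&: nbhd c = set0.
  apply/setP => x; rewrite !inE starG.
  by case: eqVneq => //= ->; rewrite eqxx.
have -> : ~: [set c] :&: nbhd c = ~: [set c].
  apply/setP => x; rewrite !inE starG eqxx andbT.
  by rewrite (eq_sym c) andbb.
by rewrite cards0 -(cardsC [set c]) cards1 add1n ltnS.
Qed.

Lemma star_gda_partition_card (P : {set {set G}}) :
  gda_partition P -> 1 < #|P| -> #|G| = 2.
Proof.
case/andP=> partP /forall_inP gdaP P_gt1.
have trivP := partition_trivIset partP.
have c_cover : c \in cover P by rewrite (cover_partition partP).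
set T := pblock P c.
have TP : T \in P by rewrite pblock_mem.
have cT : c \in T by rewrite mem_pblock.
have /card_gt0P[S] : 0 < #|P :\ T|.
  by move: P_gt1; rewrite (cardsD1 T P) TP.
rewrite !inE => /andP[ST SP].
have disST : [disjoint S & T] by apply: (trivIsetP trivP).
have cS : c \notin S by rewrite (disjointFl disST).
have /andP[_ domS] := gdaP S SP.
have TE : T = [set c].
  apply/setP => x; rewrite inE; case: eqVneq => [-> //|xc].
  by rewrite (disjointFr disST) // star_dominating.
have /andP[defT _] := gdaP T TP.
apply/eqP; rewrite eqn_leq star_center_alone_card -?TE //=.
(* The lower bound comes from [S], which is nonempty and avoids [c]. *)
have /set0Pn[x xS] : S != set0 by case/andP: domS.
have xc : x != c by apply: contraNneq cS => <-.
by have := max_card (mem [set x; c]); rewrite cards2 xc.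
Qed.

Lemma star_singletons_gda_partition :
  #|G| = 2 -> gda_partition [set [set x] | x in G].
Proof.
move=> G2; apply/andP; split.
  apply/and3P; split.
  - apply/eqP/setP => x; rewrite inE; apply/bigcupP.
    by exists [set x]; [apply: imset_f | rewrite set11].
  - apply/trivIsetP => _ _ /imsetP[x _ ->] /imsetP[y _ ->] neq.
    by rewrite disjoints1 inE; apply: contraNneq neq => ->.
  - by apply/imsetP => -[x _ /setP/(_ x)]; rewrite !inE eqxx.
apply/forall_inP => _ /imsetP[x _ ->].
have x0 : [set x] != set0 by apply/set0Pn; exists x; rewrite set11.
(* At most one neighbour lies outside [[set x]], and the [+ 1] in the defence condition absorbs
   it. *)
have xC1 : #|~: [set x]| = 1.
  by have := cardsC [set x]; rewrite cards1 G2 => -[].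
apply/andP; split; apply/andP; split=> //; apply/forall_inP => y.
  rewrite inE => /eqP ->; rewrite addn1; apply: leq_trans (ltn0Sn _).
  by rewrite -xC1 subset_leq_card // subsetIl.
rewrite !inE => yx; apply/card_gt0P; exists x; rewrite !inE eqxx starG yx /=.
(* If neither vertex were the centre, [x], [y] and [c] would be three distinct vertices. *)
apply/negPn; rewrite negb_or; apply/negP => /andP[yc xc].
have : 2 < #|G|.
  have <- : #|[set y; x; c]| = 3.
    by rewrite setUC cardsU1 !inE cards2 yx negb_or !(eq_sym c) yc xc.
  exact: max_card.
by rewrite G2.
Qed.

Lemma star_gda_partitionable : gda_partitionable G <-> #|G| = 2.
Proof.
split=> [/gda_partitionableP[P] | G2]; first exact: star_gda_partition_card.
apply/gda_partitionableP; exists [set [set x] | x in G].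
  exact: star_singletons_gda_partition.
by rewrite card_imset ?G2 //; apply: set1_inj.
Qed.

End Star.

Local Open Scope ring_scope.

Lemma Z2_eq0_or1 (x : 'Z_2) : x = 0 \/ x = 1.
Proof. by case: x => [[|[|//]]] lt; [left | right]; apply: val_inj. Qed.

Section ZeroDivisorGraphZ2Field.

Variable F : finFieldType.

(** In a product of two fields the nonzero zero-divisors have exactly one zero coordinate; over
    ['Z_2] the second coordinate then determines the first. *)
Lemma zero_divisor_Z2_field (x : ('Z_2 * F)%type) :
  (x != 0) && zero_divisor x = (x.1 == (x.2 == 0)%:R).
Proof.
case: x => x1 x2; rewrite xpair_eqE /=.
have [-> | x2N0] := eqVneq x2 0; have [-> | ->] := Z2_eq0_or1 x1 => //=.
- apply/existsP; exists (0, 1); rewrite !xpair_eqE /= oner_eq0 /=.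
  by rewrite mul0r eqxx.
- apply/existsP; exists (1, 0); rewrite !xpair_eqE /=.
  by rewrite mulr0 eqxx.
(* Remaining case: [(1, x2)] with [x2 != 0] is a unit, so it annihilates only 0. *)
apply/negbTE/existsP => -[[y1 y2]]; rewrite !xpair_eqE /= mul1r.
rewrite mulf_eq0 (negPf x2N0) /= => /andP[/negP y0 /andP[y1_0 y2_0]].
by apply: y0; rewrite y1_0.
Qed.

Lemma card_zdg_Z2_field : #|zero_divisor_graph ('Z_2 * F)%type| = #|F|.
Proof.
have hinj : injective (fun a : F => ((a == 0)%:R : 'Z_2, a)) by move=> a b [].
rewrite -(card_imset F hinj) card_sig; apply: eq_card => -[x1 x2].
rewrite inE [LHS]zero_divisor_Z2_field; apply/eqP/imsetP => /= [-> | [a _ [-> ->]] //].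
by exists x2.
Qed.

Lemma zdg_Z2_field_star :
  exists c : zero_divisor_graph ('Z_2 * F)%type, star c.
Proof.
have cP : (((1, 0) : 'Z_2 * F) != 0) && zero_divisor ((1, 0) : 'Z_2 * F).
  by rewrite zero_divisor_Z2_field eqxx.
exists (exist (fun x : 'Z_2 * F => (x != 0) && zero_divisor x) (1, 0) cP).
case=> [[x1 x2] xP] [[y1 y2] yP]; rewrite /= /zdg_adj -!val_eqE /= !xpair_eqE /=.
move: xP yP; rewrite !zero_divisor_Z2_field /= => /eqP-> /eqP->.
rewrite mulf_eq0.
(* A vertex is the centre exactly when its second coordinate is 0. Two leaves are not adjacent
   because [x2 * y2] is nonzero in the field. *)
by have [->|_] := eqVneq x2 0; have [_|_] := eqVneq y2 0; rewrite ?andbF.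
Qed.

End ZeroDivisorGraphZ2Field.

Section TwoElementField.

Variable F : finFieldType.
Hypothesis F2 : #|F| = 2%N.

Lemma two_element_field_eq0_or1 (x : F) : x = 0 \/ x = 1.
Proof.
have : x \in [set 0; 1].
  suff -> : [set 0; 1] = [set: F] by [].
  by apply/eqP; rewrite eqEcard subsetT cardsT F2 cards2 eq_sym oner_eq0.
by rewrite !inE => /orP[] /eqP; [left | right].
Qed.

Definition nonzero_to_Z2 (x : F) : 'Z_2 := (x != 0)%:R.

Lemma nonzero_to_Z2_is_zmod_morphism : zmod_morphism nonzero_to_Z2.
Proof.
(* Characteristic two settles the case [0 - 1] of the check below. *)
have N1 : - 1 = 1 :> F.
  by case: (two_element_field_eq0_or1 (- 1)) => // /eqP; rewrite oppr_eq0 oner_eq0.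
rewrite /nonzero_to_Z2 => x y.
by have [->|->] := two_element_field_eq0_or1 x;
   have [->|->] := two_element_field_eq0_or1 y;
   rewrite ?subrr ?subr0 ?sub0r ?N1 ?oner_eq0 ?eqxx //; apply: val_inj.
Qed.

(** A product in a field is nonzero iff both factors are, and conjunction of booleans is
    multiplication of their values 0 and 1. *)
Lemma nonzero_to_Z2_is_monoid_morphism : monoid_morphism nonzero_to_Z2.
Proof.
rewrite /nonzero_to_Z2; split=> [|x y]; first by rewrite oner_eq0.
by rewrite mulf_eq0 negb_or -natrM mulnb.
Qed.

Lemma nonzero_to_Z2_bij : bijective nonzero_to_Z2.
Proof.
apply: inj_card_bij; last by rewrite F2 card_ord.
move=> x y; rewrite /nonzero_to_Z2.
by have [->|->] := two_element_field_eq0_or1 x;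
   have [->|->] := two_element_field_eq0_or1 y;
   rewrite ?oner_eq0 ?eqxx.
Qed.

HB.instance Definition _ :=
  GRing.isZmodMorphism.Build F 'Z_2 nonzero_to_Z2 nonzero_to_Z2_is_zmod_morphism.
HB.instance Definition _ :=
  GRing.isMonoidMorphism.Build F 'Z_2 nonzero_to_Z2
    nonzero_to_Z2_is_monoid_morphism.

Lemma two_element_field_isomorphic_Z2 : ring_isomorphic F 'Z_2.
Proof. by exists nonzero_to_Z2; apply: nonzero_to_Z2_bij. Qed.

End TwoElementField.

Lemma ring_isomorphic_Z2 (F : finFieldType) :
  ring_isomorphic F 'Z_2 <-> #|F| = 2%N.
Proof.
split=> [[f /bij_eq_card] | ]; last exact: two_element_field_isomorphic_Z2.
by rewrite card_ord.
Qed.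

Local Close Scope ring_scope.

Theorem theorem3p6 (F : finFieldType) :
  gda_partitionable (zero_divisor_graph ('Z_2 * F)%type) <->
  ring_isomorphic F 'Z_2.
Proof.
have [c starc] := zdg_Z2_field_star F.
(* Both sides are compared with [#|F| = 2], since the star has [#|F|] vertices. *)
have := star_gda_partitionable starc; rewrite card_zdg_Z2_field => partF.
exact: iff_trans partF (iff_sym (ring_isomorphic_Z2 F)).
Qed.
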